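(* If $F$ is a forest with at least one edge, then $$a(F)-\alpha(F)\leq \left\lfloor\frac{\mu(F)-1}{2}\right\rfloor .$$ Moreover, for every integer $s\geq 1$ there is a tree $T$ with $\mu(T)=s$ and $a(T)-\alpha(T)=\lfloor (s-1)/2\rfloor$.
   Context: All graphs are finite, simple and undirected. For a graph $G$, $m(G)$ is the number of edges, $\alpha(G)$ is the independence number, and $\mu(G)$ is the matching number (maximum size of a set of pairwise disjoint edges). If $d_1\leq d_2\leq\cdots\leq d_n$ is the degree sequence of $G$, the annihilation number is $a(G)=\max\{k : \sum_{i=1}^k d_i\leq m(G)\}$. *)

(* Defs.v *)
From mathcomp Require Import all_boot.

Set Implicit Arguments.
Unset Strict Implicit.
Unset Printing Implicit Defensive.

Record sgraph := SGraph {
  vertex :> finType;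
  adj : rel vertex;
  adj_sym : symmetric adj;
  adj_irrefl : irreflexive adj
}.

Section Invariants.
Variable G : sgraph.

Definition edges : {set {set G}} :=
  [set E | [exists x : G, exists y : G, adj x y && (E == [set x; y])]].

Definition num_edges : nat := #|edges|.

Definition degree (x : G) : nat := #|[set y : G | adj x y]|.

Definition degree_seq : seq nat := sort leq [seq degree x | x <- enum G].

Definition annihilation_number : nat :=
  \max_(k < #|G|.+1 | sumn (take k degree_seq) <= num_edges) k.

Definition independent (S : {set G}) : bool :=
  [forall x in S, forall y in S, ~~ adj x y].

Definition independence_number : nat :=
  \max_(S : {set G} | independent S) #|S|.

Definition matching (M : {set {set G}}) : bool :=
  (M \subset edges) && trivIset M.

Definition matching_number : nat :=
  \max_(M : {set {set G}} | matching M) #|M|.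

(* A closed walk x -> y -> x satisfies [ucycle] with length 2, hence the
   lower bound on the length of a graph cycle. *)
Definition is_forest : Prop :=
  forall c : seq G, 2 < size c -> ~~ ucycleb (@adj G) c.

Definition is_connected : Prop :=
  0 < #|G| /\ forall x y : G, connect (@adj G) x y.

Definition is_tree : Prop := is_connected /\ is_forest.

End Invariants.

(* Main.v *)
(** Let [L] consist of [a(F)] vertices of smallest degree and let [H] be its
    complement.  Counting incidences in [L], the condition
    [\sum_(x in L) deg x <= m] says that at most as many edges lie inside [L]
    as inside [H], and in a forest the latter are fewer than [#|H|].  A matching
    has at most [#|H|] edges meeting [H], so [mu < 2 #|H| = 2 (n - a)].
    Since [n <= alpha + mu] (König, by removing leaves), the bound follows.
    It is attained by the corona of a star, whose pendant edges form a perfect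
    matching. *)
Require Import Defs.
From mathcomp Require Import all_boot all_order all_algebra zify.

Set Implicit Arguments.
Unset Strict Implicit.
Unset Printing Implicit Defensive.

(** * Double counting, and sums over sorted sequences *)

Lemma sum_card_setI (T : finType) (E : {set {set T}}) (A : {set T}) :
  \sum_(e in E) #|e :&: A| = \sum_(x in A) #|[set e in E | x \in e]|.
Proof.
under eq_bigr do rewrite -sum1dep_card.
under [RHS]eq_bigr do rewrite -sum1dep_card.
rewrite (exchange_big_dep (fun x => x \in A)) /=; last by move=> e x _ /andP[].
by apply: eq_bigr => x xA; apply: eq_bigl => e; rewrite xA andbT.
Qed.

(** A prefix of a sorted sequence is the cheapest subsequence of its length. If the heads of [t] and
    [u] differ, [u] lies in the tail of [t], so its head is at least that of [t]. *)
Lemma sumn_take_sorted_leq (t u : seq nat) :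
  sorted leq t -> subseq u t -> sumn (take (size u) t) <= sumn u.
Proof.
elim: t u => [|x t IHt] [|y u] //= x_t.
have t_sorted := path_sorted x_t.
case: eqP => [-> /IHt|_ yu_t]; first by rewrite leq_add2l; exact.
apply: leq_add; last exact/IHt/(subseq_trans (subseq_cons u y)).
have /allP := order_path_min leq_trans x_t.
by apply; apply: (mem_subseq yu_t); rewrite mem_head.
Qed.

(** * Degrees, annihilation number and matchings in an arbitrary graph *)

Section Graph.
Variable G : sgraph.
Implicit Types (x y u v : G) (e A C L S : {set G}) (M : {set {set G}}).

Lemma edgesP e :
  reflect (exists x y, adj x y /\ e = [set x; y]) (e \in edges G).
Proof.
rewrite inE; apply: (iffP existsP) => [[x /existsP[y /andP[xy /eqP->]]]|].
  by exists x, y.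
by case=> x [y [xy ->]]; exists x; apply/existsP; exists y; rewrite xy /=.
Qed.

Lemma adj_neq x y : adj x y -> x != y.
Proof. by apply: contraTneq => ->; rewrite adj_irrefl. Qed.

Lemma card_edge e : e \in edges G -> #|e| = 2.
Proof. by case/edgesP=> x [y [/adj_neq xy ->]]; rewrite cards2 xy. Qed.

Lemma degree_card_edges x : degree x = #|[set e in edges G | x \in e]|.
Proof.
rewrite /degree -(card_in_imset (f := fun y => [set x; y])); last first.
  move=> y z; rewrite !inE => /adj_neq xy _ /setP/(_ y).
  by rewrite !inE eqxx orbT [y == x]eq_sym (negPf xy) => /esym/eqP.
apply: eq_card => e; rewrite [RHS]inE; apply/imsetP/andP => [[y + ->]|[]].
  rewrite inE => xy; rewrite set21; split=> //; apply/edgesP.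
  by exists x, y.
case/edgesP=> y [z [yz ->]] /set2P[->|->]; first by exists z; rewrite ?inE.
by exists y; rewrite ?inE 1?setUC // adj_sym.
Qed.

(** With the next lemma, this trades prefixes of the degree sequence for vertex sets. The sorted
    degrees of [L] form a subsequence of [degree_seq], so the prefix of length [#|L|] sums to no
    more. *)
Lemma annihilation_number_ge L :
  \sum_(x in L) degree x <= num_edges G -> #|L| <= annihilation_number G.
Proof.
move=> degL; have ltL : #|L| < #|G|.+1 by rewrite ltnS max_card.
apply: (bigmax_sup (Ordinal ltL)) => //=; apply: leq_trans degL.
pose u := sort leq [seq degree x | x <- enum L].
have <- : size u = #|L| by rewrite size_sort size_map -cardE.
have -> : \sum_(x in L) degree x = sumn u.
  by rewrite (perm_sumn (permEl (perm_sort _ _))) sumnE big_map big_enum.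
apply: sumn_take_sorted_leq; first exact: sort_sorted leq_total _.
apply: subseq_sort; [exact: leq_total | exact: leq_trans | apply: map_subseq].
have -> : enum L = [seq x <- enum G | x \in L] by rewrite enumT.
exact: filter_subseq.
Qed.

Lemma annihilation_number_set : exists2 L : {set G},
  #|L| = annihilation_number G & \sum_(x in L) degree x <= num_edges G.
Proof.
(* The empty prefix is admissible, so the maximum is attained at some [k]; the set sought is the
   first [k] vertices sorted by degree. *)
rewrite /annihilation_number (bigmax_eq_arg ord0) ?take0 //.
case: arg_maxnP => [|k degk _]; first by rewrite take0.
pose s := sort (relpre (@degree G) leq) (enum G).
have uniq_s : uniq (take k s) by rewrite take_uniq // sort_uniq enum_uniq.
exists [set x in take k s].
  rewrite cardsE (card_uniqP uniq_s) size_takel //.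
  by rewrite size_sort -cardE -ltnS.
rewrite (eq_bigl [in take k s]) => [|x]; last by rewrite inE.
rewrite -big_uniq //= -(big_map _ predT id) -sumnE map_take.
by move: degk; rewrite /degree_seq sort_map.
Qed.

(** Count incidences from the side of [A]: each vertex lies in at most one edge of [M]. *)
Lemma leq_card_matching M A :
  matching M -> \sum_(e in M) #|e :&: A| <= #|A|.
Proof.
case/andP=> _ /trivIsetP dM; rewrite sum_card_setI -sum1_card.
apply: leq_sum => x _; apply/card_le1_eqP => e f.
rewrite !inE => /andP[eM xe] /andP[fM xf]; apply: contraTeq xf => fe.
by rewrite (disjointFl (dM _ _ fM eM fe)).
Qed.

(** Every edge of [M] has an endpoint outside [S], and these endpoints are distinct. *)
Lemma independentC_matching S M :
  independent S -> matching M -> #|S| + #|M| <= #|G|.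
Proof.
move=> /forall_inP indS matM; rewrite -(cardsC S) leq_add2l.
apply: leq_trans (leq_card_matching (~: S) matM); rewrite -sum1_card.
apply: leq_sum => e eM; rewrite card_gt0.
case/andP: matM => /subsetP/(_ _ eM)/edgesP[x [y [xy ->]]] _.
case xS: (x \in S); last by apply/set0Pn; exists x; rewrite !inE eqxx xS.
apply/set0Pn; exists y; rewrite !inE eqxx orbT /=.
by apply: contraL xy; move/forall_inP: (indS _ xS); apply.
Qed.

(* Each edge [e] satisfies [1 + (e \subset L) <= #|e :&: L| + (e \subset ~: L)]. *)
Lemma edges_low_degree L : \sum_(x in L) degree x <= num_edges G ->
  #|[set e in edges G | e \subset L]| <= #|[set e in edges G | e \subset ~: L]|.
Proof.
under eq_bigr do rewrite degree_card_edges.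
rewrite -sum_card_setI => degL; rewrite -(leq_add2l (num_edges G)).
apply: leq_trans (leq_add degL (leqnn _)).
rewrite /num_edges -[#|edges G|]sum1_card -!sum1dep_card !big_mkcondr.
rewrite -!big_split /=.
apply: leq_sum => e eE; have := cardsID L e; rewrite (card_edge eE).
rewrite -!setD_eq0 -!cards_eq0 [in e :\: ~: L]setDE setCK.
by case: eqP; case: eqP; lia.
Qed.

End Graph.

(** * Forests: leaves, edge counts, König's theorem and the main inequality *)

Section Forest.
Variable G : sgraph.
Hypothesis forestG : is_forest G.
Implicit Types (x y u v : G) (e A C L S : {set G}) (M : {set {set G}}).

(* Otherwise a path inside [A] could be prolonged forever without closing a
   cycle. *)
Lemma forest_leaf A e : e \in edges G -> e \subset A ->
  exists v u, [/\ v \in A, u \in A, adj v u &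
                  forall w, w \in A -> adj v w -> w = u].
Proof.
case/edgesP=> x0 [y0 [xy0 ->]]; rewrite subUset !sub1set => /andP[x0A y0A].
pose leaf v u := [&& u \in A, adj v u &
                     [forall w in A, adj v w ==> (w == u)]].
have [/exists_inP[v vA /existsP[u]]|no_leaf] :=
  boolP [exists v in A, exists u, leaf v u].
  case/and3P=> uA vu /forall_inP wu; exists v, u; split=> // w wA vw.
  by apply/eqP; move/implyP: (wu _ wA); apply.
(* Without a leaf, paths of [n + 2] distinct vertices exist for every [n]; taking [n] to be [#|G|]
   is absurd. *)
suff /(_ #|G|) [x [y [p [/card_uniqP p_size _ _ p_n]]]] n : exists x y p,
    [/\ uniq [:: x, y & p], {subset [:: x, y & p] <= A},
        path (@adj G) x (y :: p) & size p = n].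
  have := max_card [in [:: x, y & p]].
  by rewrite p_size /= p_n ltnNge leqnSn.
elim: n => [|n [x [y [p [xyp_uniq xypA xyp_path p_n]]]]].
  exists x0, y0, [::]; split=> //=; last by rewrite xy0.
    by rewrite inE adj_neq.
  by move=> z; rewrite !inE => /orP[]/eqP->.
have xA : x \in A by rewrite xypA ?mem_head.
have yA : y \in A by rewrite xypA // !inE eqxx orbT.
have xy : adj x y by case/andP: xyp_path.
have /existsP[z /and3P[zA xz zy]] : [exists z, [&& z \in A, adj x z & z != y]].
  apply: contraR no_leaf; rewrite negb_exists => /forallP nz.
  apply/exists_inP; exists x => //; apply/existsP; exists y.
  apply/and3P; split=> //; apply/forall_inP => w wA; apply/implyP => xw.
  by move: (nz w); rewrite wA xw negbK.
have zx : z != x by rewrite eq_sym adj_neq.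
(* If the new neighbour [z] of [x] is already on the path, the segment from [x] through [y] to [z]
   closes into a cycle of length at least 3. Otherwise [z] is put in front of [x]. *)
have [zp|zp] := boolP (z \in p).
  case/splitPr: zp xyp_uniq xyp_path => p1 p2 xyp_uniq xyp_path.
  have := forestG (c := [:: x, y & rcons p1 z]); rewrite /= size_rcons => /(_ isT).
  case/negP; rewrite /ucycleb; apply/andP; split.
    move: xyp_path; rewrite /= -!cats1 -catA /= cat_path /= => /and4P[-> p1y].
    by rewrite !cat_path /= p1y => -> _; rewrite adj_sym xz.
  move: xyp_uniq; rewrite -cat_rcons -!cat_cons cat_uniq => /andP[] //.
exists z, x, (y :: p); split=> /=; last by rewrite p_n.
- by rewrite inE negb_or zx inE negb_or zy zp.
- by move=> w; rewrite inE => /predU1P[->|/xypA].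
- by rewrite adj_sym xz.
Qed.

(** Induction on [#|A|]: deleting a leaf [v] of the subgraph induced on [A] loses one vertex and
    only the edge to its neighbour [u], which remains and keeps the set nonempty. *)
Lemma forest_edges_lt A :
  A != set0 -> #|[set e in edges G | e \subset A]| < #|A|.
Proof.
have [n] := ubnP #|A|; elim: n A => // n IHn A ltAn An0.
have [->|/set0Pn[e]] := eqVneq [set e in edges G | e \subset A] set0.
  by rewrite cards0 card_gt0.
rewrite inE => /andP[eE eA]; have [v [u [vA uA vu v_leaf]]] := forest_leaf eE eA.
have sub : [set e in edges G | e \subset A]
    \subset [set v; u] |: [set e in edges G | e \subset A :\ v].
  apply/subsetP => f; rewrite inE => /andP[fE fA].
  rewrite in_setU1 inE fE subsetD1 fA /=.
  have [vf|] := boolP (v \in f); rewrite ?orbT ?orbF //.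
  case/edgesP: fE fA vf => x [y [xy ->]].
  rewrite subUset !sub1set => /andP[xA yA] /set2P[] ?; subst v.
    by rewrite (v_leaf y).
  by rewrite (v_leaf x) 1?adj_sym // setUC.
apply: leq_ltn_trans (subset_leq_card sub) _; rewrite (cardsD1 v A) vA.
apply: leq_ltn_trans (leq_of_leqif (leq_card_setU _ _)) _.
rewrite cards1 ltn_add2l; apply: IHn; first by rewrite (cardsD1 v A) vA in ltAn.
by apply/set0Pn; exists u; rewrite !inE uA eq_sym (adj_neq vu).
Qed.

(** König's theorem inside [A], with [C] a vertex cover. A pendant edge [[set v; u]] joins the
    matching and the leaf's neighbour [u] joins the cover; the induction continues on [A] without
    both. An edge in [A] that avoids [u] also avoids the leaf [v], so it is covered by induction. *)
Lemma forest_cover_matching A : exists C M,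
  [/\ matching M, {in M, forall e, e \subset A},
      {in edges G, forall e, e \subset A -> ~~ [disjoint e & C]}
    & #|C| <= #|M|].
Proof.
have [n] := ubnP #|A|; elim: n A => // n IHn A ltAn.
have [E0|/set0Pn[e]] := eqVneq [set e in edges G | e \subset A] set0.
  exists set0, set0; split=> [|e|e eE eA|]; rewrite ?cards0 ?inE //.
    by rewrite /matching sub0set; apply/trivIsetP=> e f; rewrite inE.
  by have /setP/(_ e) := E0; rewrite inE in_set0 eE eA.
rewrite inE => /andP[eE eA]; have [v [u [vA uA vu v_leaf]]] := forest_leaf eE eA.
have uvE : [set v; u] \in edges G by apply/edgesP; exists v, u.
have [|C [M [/andP[ME dM] MA' CA' leCM]]] := IHn (A :\: [set v; u]).
  rewrite -ltnS; apply: leq_trans ltAn; rewrite ltnS; apply: proper_card; apply/properP; split.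
    exact: subsetDl.
  by exists v; rewrite // !inE eqxx.
have uvM : {in M, forall e, [disjoint [set v; u] & e]}.
  move=> f /MA'; rewrite disjoint_sym => fA'.
  by move: fA'; rewrite subsetD => /andP[].
have M0 : set0 \notin M.
  by apply: contraTN isT => /(subsetP ME)/card_edge; rewrite cards0.
have [dM' uv_notM] := trivIsetU1 uvM dM M0.
exists (u |: C), ([set v; u] |: M); split.
- by rewrite /matching dM' subUset sub1set uvE ME.
- move=> f /setU1P[->|/MA']; first by rewrite subUset !sub1set vA uA.
  by rewrite subsetD => /andP[].
- move=> f fE fA; have [uf|uf] := boolP (u \in f).
    by apply/pred0Pn; exists u; rewrite /= uf !inE eqxx.
  have vf : v \notin f.
    apply: contraNN uf; case/edgesP: fE fA => x [y [xy ->]].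
    rewrite subUset !sub1set => /andP[xA yA] /set2P[] ?; subst v.
      by rewrite -(v_leaf y) // !inE eqxx orbT.
    by rewrite -(v_leaf x) 1?adj_sym // !inE eqxx.
  have /CA' := fE; rewrite subsetD fA disjoint_sym disjoints_subset.
  rewrite subUset !sub1set !inE uf vf => /(_ isT)/pred0Pn[x /= /andP[xf xC]].
  by apply/pred0Pn; exists x; rewrite /= xf inE xC orbT.
- rewrite [#|_ |: M|]cardsU1 uv_notM.
  by apply: leq_trans (leq_of_leqif (leq_card_setU _ _)) _; rewrite cards1 ltnS.
Qed.

(** The complement of a vertex cover is independent. *)
Lemma forest_konig : #|G| <= independence_number G + matching_number G.
Proof.
have [C [M [matM _ CE leCM]]] := forest_cover_matching setT.
rewrite -(cardsC C) addnC leq_add //; last first.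
  exact: leq_trans leCM (leq_bigmax_cond _ matM).
apply: (leq_bigmax_cond (F := fun S : {set G} => #|S|)).
apply/forall_inP => x xC; apply/forall_inP => y yC; apply/negP => xy.
have /CE/(_ (subsetT _))/pred0Pn[z /=] : [set x; y] \in edges G.
  by apply/edgesP; exists x, y.
by case/andP=> /set2P[]->; apply/negP; rewrite -in_setC.
Qed.

Lemma forest_annihilation_matching : 0 < num_edges G ->
  matching_number G + 2 * annihilation_number G < 2 * #|G|.
Proof.
move=> E_gt0; have [L <- degL] := annihilation_number_set G.
have le_edges := edges_low_degree degL.
(* If [L] were everything, all edges would lie inside [L] and none inside its complement, against
   [le_edges]. *)
have H_gt0 : ~: L != set0.
  apply: contraTneq E_gt0 => H0; rewrite -leqNgt.
  have LT : L = setT by rewrite -[L]setCK H0 setC0.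
  rewrite H0 LT in le_edges; move: le_edges.
  rewrite (eq_card (B := edges G)) => [|e]; last by rewrite !inE subsetT andbT.
  move/leq_trans; apply; rewrite leqn0 cards_eq0; apply/eqP/setP=> e.
  rewrite [RHS]inE inE subset0; apply: contraTF isT => /andP[/card_edge + /eqP e0].
  by rewrite e0 cards0.
have lt_edges := forest_edges_lt H_gt0.
(* A matching edge meets the complement of [L] or lies inside [L]. By [le_edges] and [lt_edges] the
   second summand is less than [#|~: L|]. *)
suff : matching_number G <= #|~: L| + #|[set e in edges G | e \subset L]|.
  by have := cardsC L; lia.
apply/bigmax_leqP => M matM; have /andP[/subsetP ME _] := matM.
apply: leq_trans (leq_add (leq_card_matching (~: L) matM)
  (subset_leq_card (_ : [set e in M | e \subset L] \subset _))); last first.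
  by apply/subsetP => e; rewrite inE => /andP[/ME eE eL]; rewrite inE eE.
rewrite -sum1dep_card big_mkcondr -big_split -sum1_card /=.
apply: leq_sum => e eM; have := cardsID L e; rewrite (card_edge (ME e eM)).
by rewrite -setD_eq0 -cards_eq0 -setDE; case: eqP; lia.
Qed.

End Forest.

(** * Trees described by a parent function *)

Section ParentGraph.
Variables (V : finType) (parent : V -> V) (depth : V -> nat) (r : V).

(** The root will be its own parent; the conjunct [x != y] discards the resulting loop. *)
Definition parent_adj (x y : V) : bool :=
  (x != y) && ((parent x == y) || (parent y == x)).

Lemma parent_adj_sym : symmetric parent_adj.
Proof. by move=> x y; rewrite /parent_adj eq_sym orbC. Qed.

Lemma parent_adj_irrefl : irreflexive parent_adj.
Proof. by move=> x; rewrite /parent_adj eqxx. Qed.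

Definition parent_graph : sgraph := SGraph parent_adj_sym parent_adj_irrefl.

Hypothesis parent_root : parent r = r.
Hypothesis depth_parent : forall x, x != r -> depth (parent x) < depth x.

Lemma parent_neq x : x != r -> x != parent x.
Proof. by move/depth_parent; apply: contraTneq => <-; rewrite ltnn. Qed.

Lemma adj_parent x : x != r -> parent_adj x (parent x).
Proof. by move=> xr; rewrite /parent_adj parent_neq //= eqxx. Qed.

(** Were [x] the parent of [y] instead, [y] would be strictly deeper; [y] cannot be the root, since
    then [x] would equal [y]. *)
Lemma adj_deeper x y : parent_adj x y -> depth y <= depth x -> y = parent x.
Proof.
case/andP=> xy /orP[/eqP-> //|/eqP yx]; rewrite leqNgt -yx depth_parent //.
by apply: contraNneq xy => yr; rewrite -yx yr parent_root.
Qed.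

Lemma parent_graph_tree : is_tree parent_graph.
Proof.
have conn_r x : connect parent_adj x r.
  have [n] := ubnP (depth x); elim: n x => // n IHn x ltxn.
  have [->|xr] := eqVneq x r; first exact: connect0.
  apply: connect_trans (connect1 (adj_parent xr)) (IHn _ _).
  exact: leq_trans (depth_parent xr) ltxn.
split.
  split=> [|x y]; first by apply/card_gt0P; exists r.
  apply: connect_trans (conn_r x) _.
  by rewrite (sym_connect_sym parent_adj_sym) conn_r.
(* Both cycle neighbours of a deepest vertex would be its parent. *)
move=> c c_size; apply/negP => c_cycle.
have [x0 x0c] : exists x0, x0 \in c.
  by case: c c_size {c_cycle} => // x c _; exists x; rewrite mem_head.
have [x xc x_max] := arg_maxnP depth x0c.
have [i p rot_c] := rot_to xc.
have {}x_max y : y \in x :: p -> depth y <= depth x.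
  by rewrite -rot_c mem_rot => /x_max.
have p_size : 1 < size p by move: c_size; rewrite -(size_rot i) rot_c.
have : ucycle parent_adj (x :: p) by rewrite -rot_c rot_ucycle; exact: c_cycle.
(* The cycle now starts at [x], so its neighbours there are the first and last of the other
   vertices, [y] and [z]. These are distinct because at least two vertices remain. *)
case/lastP: p p_size x_max {rot_c} => // -[|y p] z //= _ x_max.
case/andP; rewrite /= rcons_path last_rcons => /andP[xy /andP[_ zx]].
case/and3P=> _ /negP[]; rewrite (adj_deeper xy) ?x_max ?inE ?eqxx ?orbT //.
rewrite -(adj_deeper (_ : parent_adj x z)) ?mem_rcons ?mem_head //.
  by rewrite parent_adj_sym.
by rewrite x_max // !inE mem_rcons mem_head !orbT.
Qed.

(** Each vertex other than [r] contributes the edge to its parent. Two vertices giving the same edge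
    would be each other's parent, each strictly deeper than the other. *)
Lemma parent_graph_edges : #|V| <= (num_edges parent_graph).+1.
Proof.
rewrite -cardsT (cardsD1 r) inE /= ltnS.
rewrite -(card_in_imset (f := fun x => [set x; parent x])).
  apply/subset_leq_card/subsetP => _ /imsetP[x /setD1P[xr _] ->].
  by apply/edgesP; exists x, (parent x); split=> //; apply: adj_parent.
move=> x y /setD1P[xr _] /setD1P[yr _] exy.
have : x \in [set y; parent y] by rewrite -exy set21.
have : y \in [set x; parent x] by rewrite exy set21.
rewrite !inE => /predU1P[//|/eqP yx] /predU1P[//|/eqP xy].
by have := depth_parent xr; have := depth_parent yr; rewrite -yx -xy; lia.
Qed.

End ParentGraph.

(** * The extremal tree and its invariants *)

Section Spider.
Variable s : nat.

(** The vertices [(i, false)] form the star centred at [(ord0, false)], and [(i, true)] is the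
    pendant vertex attached to [(i, false)]. *)
Definition spider_parent (x : 'I_s.+1 * bool) : 'I_s.+1 * bool :=
  if x.2 then (x.1, false) else (ord0, false).

(* The corona of the star [K_(1,s)]: a centre with one leg of length 1 and [s]
   legs of length 2. *)
Definition spider : sgraph := parent_graph spider_parent.

Let spider_depth (x : 'I_s.+1 * bool) : nat := (x.1 != ord0) + x.2.

Let depth_spider_parent x :
  x != (ord0, false) -> spider_depth (spider_parent x) < spider_depth x.
Proof.
case: x => i [] /=; rewrite /spider_depth /spider_parent /= ?addn1 ?addn0 //.
by rewrite xpair_eqE eqxx andbT => ->.
Qed.

Lemma card_spider : #|spider| = 2 * s.+1.
Proof. by rewrite card_prod card_ord card_bool mulnC. Qed.

Lemma spider_tree : is_tree spider.
Proof. exact: parent_graph_tree depth_spider_parent. Qed.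

Lemma spider_edges : 2 * s + 1 <= num_edges spider.
Proof.
have := parent_graph_edges depth_spider_parent.
by rewrite -/spider [#|_|]card_spider; lia.
Qed.

Let rungs : {set {set spider}} :=
  [set [set ((i, false) : spider); (i, true)] | i : 'I_s.+1].

Let matching_rungs : matching rungs.
Proof.
apply/andP; split.
  apply/subsetP => _ /imsetP[i _ ->]; apply/edgesP.
  exists (i, false), (i, true); split=> //=.
  by rewrite /parent_adj !xpair_eqE /= !eqxx !andbF orbT.
apply/trivIsetP => _ _ /imsetP[i _ ->] /imsetP[j _ ->] ij.
have {}ij : i != j by apply: contraNneq ij => ->.
rewrite disjoints_subset subUset !sub1set !inE !xpair_eqE /=.
by rewrite !andbF !andbT !orbF (negPf ij).
Qed.

Let card_rungs : #|rungs| = s.+1.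
Proof.
rewrite card_imset ?card_ord // => i j /setP/(_ (i, false)).
by rewrite !inE !xpair_eqE eqxx /= !andbT !andbF orbF => /esym/eqP.
Qed.

Lemma spider_matching_number : matching_number spider = s.+1.
Proof.
apply/eqP; rewrite eqn_leq -{2}card_rungs.
rewrite (leq_bigmax_cond (F := fun M : {set {set spider}} => #|M|)) // andbT.
apply/bigmax_leqP => M matM; have /andP[/subsetP ME _] := matM.
(* Over the full vertex set each edge counts twice, so [2 * #|M|] is at most [2 * s.+1]. *)
have := leq_card_matching setT matM.
rewrite (eq_bigr (fun=> 2)) => [|e /ME eE]; last by rewrite setIT card_edge.
by rewrite sum_nat_const cardsT card_spider; lia.
Qed.

Lemma spider_independence_number : independence_number spider <= s.+1.
Proof.
apply/bigmax_leqP => S indS; have := independentC_matching indS matching_rungs.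
by rewrite card_rungs card_spider; lia.
Qed.

Lemma degree_spider_leaf i : degree ((i, true) : spider) <= 1.
Proof.
rewrite /degree -(cards1 ((i, false) : spider)); apply/subset_leq_card/subsetP.
case=> j b; rewrite !inE /= /parent_adj /= => /andP[_].
case: b; rewrite /spider_parent !xpair_eqE /= ?andbF ?andbT ?orbF //.
by rewrite eq_sym.
Qed.

Lemma degree_spider_mid i : i != ord0 -> degree ((i, false) : spider) <= 2.
Proof.
move=> i0; rewrite /degree.
apply: (@leq_trans #|[set ((i, true) : spider); (ord0, false)]|).
  apply/subset_leq_card/subsetP => -[j b].
  rewrite !inE /= /parent_adj /spider_parent /= => /andP[_].
  case: b; rewrite !xpair_eqE /= ?andbT ?andbF ?orbF //=.
  by rewrite [ord0 == i]eq_sym (negPf i0) orbF eq_sym.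
by rewrite cards2; case: (_ != _).
Qed.

(** All [s.+1] leaves together with [s./2] vertices of degree at most 2 have degree sum at most
    [s.+1 + 2 * s./2], hence at most [2 * s + 1]. *)
Lemma spider_annihilation_number : s.+1 + s./2 <= annihilation_number spider.
Proof.
pose leaves : {set spider} := [set (i, true) | i : 'I_s.+1].
(* The shift to [j.+1] avoids the centre, whose degree is [s.+1]. *)
pose mids : {set spider} := [set (inord j.+1, false) | j : 'I_s./2].
have val_mid (j : 'I_s./2) : (inord j.+1 : 'I_s.+1) = j.+1 :> nat.
  by rewrite inordK //; have := ltn_ord j; have := odd_double_half s; lia.
have card_leaves : #|leaves| = s.+1.
  by rewrite card_imset ?card_ord // => i j [].
have card_mids : #|mids| = s./2.
  rewrite card_imset ?card_ord // => i j [] /(congr1 (@nat_of_ord _)).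
  by rewrite !val_mid => -[/val_inj].
have dis : [disjoint leaves & mids].
  apply/pred0P => x /=; apply/negP => /andP[/imsetP[i _ ->] /imsetP[j _]] //.
have <- : #|leaves :|: mids| = s.+1 + s./2.
  by rewrite -card_leaves -card_mids; apply/eqP; rewrite leq_card_setU.
apply: annihilation_number_ge; apply: leq_trans spider_edges.
rewrite (eq_bigl _ _ (fun x => in_setU x leaves mids)) bigU //=.
apply: (@leq_trans (#|leaves| * 1 + #|mids| * 2)); last first.
  by rewrite card_leaves card_mids; have := odd_double_half s; lia.
rewrite -!sum_nat_const leq_add //; apply: leq_sum => _ /imsetP[i _ ->].
  exact: degree_spider_leaf.
by apply: degree_spider_mid; rewrite -val_eqE /= val_mid.
Qed.

End Spider.

Import Order.TTheory GRing.Theory Num.Theory.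
Local Open Scope ring_scope.

Theorem theoremC :
  (forall F : sgraph, is_forest F -> (0 < num_edges F)%N ->
     (annihilation_number F)%:Z - (independence_number F)%:Z
       <= (((matching_number F)%:Z - 1) %/ 2)%Z)
  /\
  (forall s : nat, (1 <= s)%N ->
     exists T : sgraph,
       [/\ is_tree T,
           matching_number T = s
         & (annihilation_number T)%:Z - (independence_number T)%:Z
             = ((s%:Z - 1) %/ 2)%Z]).
Proof.
have bound F : is_forest F -> (0 < num_edges F)%N ->
    (annihilation_number F)%:Z - (independence_number F)%:Z
      <= (((matching_number F)%:Z - 1) %/ 2)%Z.
  (* With [n] vertices, [2a < 2n - mu] and [n <= alpha + mu] give [2(a - alpha) <= mu - 1]. *)
  move=> forestF /(forest_annihilation_matching forestF).
  by have := forest_konig forestF; lia.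
(* From here [s] is the predecessor of the prescribed matching number. The upper half of the
   equality is [bound] itself; the lower half comes from the estimates on the spider. *)
split=> // -[//|s] _; exists (spider s).
have [_ forestT] := spider_tree s; have mu := spider_matching_number s.
split=> //; first exact: spider_tree.
apply/eqP; rewrite eq_le -{1}mu bound //; last first.
  by apply: leq_trans (spider_edges s); rewrite addn1.
have := spider_annihilation_number s; have := spider_independence_number s.
by have := odd_double_half s; lia.
Qed.
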